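(* Let $g$ be an Extended Deep Submodular Function (EDSF) on a finite ground set $S=\{1,\dots,n\}$, given as the minimum of DSF networks, and regard $g$ as a function of real input vectors $x$ with non-negative components by feeding $x$ to the networks. Then $g:(\mathbb{R}^+)^n\to\mathbb{R}^+$ is a concave function of the input vector.
   Context: Notation: $\mathbb{R}^+=[0,\infty)$. Deep Submodular Function (DSF) network: with $L\ge 1$ layers, defined recursively. All activation functions $\phi:\mathbb{R}^+\to\mathbb{R}^+$ are normalized ($\phi(0)=0$), non-decreasing and concave, and may differ from node to node. - A 1-layer DSF network with $k$ output nodes computes from an input $x\in(\mathbb{R}^+)^n$ the outputs $\varphi_i(x)=\phi_i\big(\sum_{j=1}^n w_{ji}x_j\big)$, $i=1,\dots,k$, with weights $w_{ji}\ge 0$. - An $L$-layer DSF network ($L>1$) with $m$ output nodes is obtained from an $(L-1)$-layer DSF network with output nodes $\varphi_1,\dots,\varphi_k$ by appending a fully connected layer, with outputs $\psi_v(x)=\phi_v\big(\sum_{u=1}^k w_{uv}\varphi_u(x)\big)+b_v$, $v=1,\dots,m$, with weights $w_{uv}\ge 0$ and biases $b_v\in\mathbb{R}^+$. A DSF $f$ is the output of a DSF network with a single output node; as a set function it is evaluated at indicator vectors, $f(A)=f(\mathbf{1}_A)$, but the network defines $f(x)$ for every $x\in(\mathbb{R}^+)^n$. EDSF: $g=\min\{f_1,\dots,f_r\}$ for some $r\ge 1$ and DSFs $f_1,\dots,f_r$; on real inputs, $g(x)=\min\{f_1(x),\dots,f_r(x)\}$ for $x\in(\mathbb{R}^+)^n$.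 *)

(* Defs.v *)
From HB Require Import structures.
From mathcomp Require Import all_boot all_order all_algebra.
From mathcomp Require Import interval_inference boolp classical_sets set_interval.
From mathcomp Require Import reals convex.

Set Implicit Arguments.
Unset Strict Implicit.
Unset Printing Implicit Defensive.

Import Order.TTheory GRing.Theory Num.Theory.

Local Open Scope classical_set_scope.
Local Open Scope ring_scope.

Definition concave_function (R : numFieldType) (E : lmodType R)
    (D : set (convex_lmodType E)) (f : E -> R) : Prop :=
  convex_function D (fun x => - f x).

Definition nonneg_orthant (R : realType) (n : nat) : set 'rV[R]_n :=
  [set x : 'rV[R]_n | forall j, 0 <= x 0 j].

Arguments nonneg_orthant : clear implicits.

(* A function from [0, +oo[ to [0, +oo[ is represented by a total function on
   R; its values at negative arguments are arbitrary. *)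
Record activation (R : realType) : Type := Activation {
  activation_fun :> R -> R;
  activation_ge0 : forall t, 0 <= t -> 0 <= activation_fun t;
  activation0 : activation_fun 0 = 0;
  activation_nondecreasing :
    {in `[0, +oo[ &, {homo activation_fun : s t / s <= t}};
  activation_concave :
    concave_function (E := R^o) [set` `[0, +oo[] activation_fun }.

(* [dsf_network R n k]: DSF networks with [n] inputs and [k] output nodes; the
   number of layers is the number of constructors, hence at least 1. The entry
   [w u v] is the weight of the edge from node [u] to node [v] of the next
   layer. Only the appended layers carry biases. *)
Inductive dsf_network (R : realType) (n : nat) : nat -> Type :=
| FirstLayer (k : nat) (phi : 'I_k -> activation R)
    (w : 'M[{nonneg R}]_(n, k)) : dsf_network R n k
| AppendLayer (k m : nat) (N : dsf_network R n k) (phi : 'I_m -> activation R)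
    (w : 'M[{nonneg R}]_(k, m)) (b : 'rV[{nonneg R}]_m) : dsf_network R n m.

Fixpoint dsf_output (R : realType) (n k : nat) (N : dsf_network R n k)
    (x : 'rV[R]_n) : 'I_k -> R :=
  match N in dsf_network _ _ k return 'I_k -> R with
  | FirstLayer _ phi w =>
      fun i => phi i (\sum_j (w j i)%:num * x 0 j)
  | AppendLayer _ _ N phi w b =>
      fun v => phi v (\sum_u (w u v)%:num * dsf_output N x u) + (b 0 v)%:num
  end.

Definition dsf (R : realType) (n : nat) : Type := dsf_network R n 1.

Definition dsf_fun (R : realType) (n : nat) (f : dsf R n) (x : 'rV[R]_n) : R :=
  dsf_output f x ord0.

(* A nonempty finite family, possibly with repetitions, of DSFs. *)
Record edsf (R : realType) (n : nat) : Type := EDSF {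
  edsf_size : nat;
  edsf_component : 'I_edsf_size.+1 -> dsf R n }.

Arguments edsf_component {R n} g i : rename.

(* The minimum has no neutral element in R: the first component is used as the
   initial value. *)
Definition edsf_fun (R : realType) (n : nat) (g : edsf R n) (x : 'rV[R]_n) : R :=
  \big[Num.min/dsf_fun (edsf_component g ord0) x]_i
    dsf_fun (edsf_component g i) x.

(* Main.v *)
(** Concavity propagates through the layers: a nonnegative combination of
    nonnegative concave functions is again such a function, so is its image
    under a nondecreasing concave activation, and pointwise minima preserve both
    properties. Monotonicity is what makes the composition concave:
    [t phi (f x) + (1 - t) phi (f y) <= phi (t f x + (1 - t) f y)
     <= phi (f (t x + (1 - t) y))]. *)
Require Import Defs.
From mathcomp Require Import all_boot all_order all_algebra.
From mathcomp Require Import interval_inference boolp.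
From mathcomp Require Import classical_sets reals convex.

Import Order.TTheory GRing.Theory Num.Theory.

Local Open Scope classical_set_scope.
Local Open Scope ring_scope.
Local Open Scope convex_scope.

Section ConcaveFunctions.
Context {R : realType} {E : lmodType R} {D : set (convex_lmodType E)}.
Implicit Types f : E -> R.

(** Negation commutes with convex combinations ([convN]), so convexity of [- f] turns into the usual
    inequality between real numbers, the form in which the later lemmas use concavity. *)
Lemma concave_functionP f :
  concave_function D f <->
  forall (t : {i01 R}) (x y : convex_lmodType E), D x -> D y ->
    t%:num * f x + (1 - t%:num) * f y <= f (x <| t |> y).
Proof.
split=> [fD t x y Dx Dy|fD t x y /set_mem Dx /set_mem Dy].
  by have := fD t x y (mem_set Dx) (mem_set Dy); rewrite -convN lerN2.
by rewrite -convN lerN2; exact: fD.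
Qed.

Lemma concave_function_cst (c : R) : concave_function D (fun=> c).
Proof. by apply/concave_functionP => t x y _ _; rewrite -mulrDl subrKC mul1r. Qed.

Lemma concave_functionD f g : concave_function D f -> concave_function D g ->
  concave_function D (fun x => f x + g x).
Proof.
move=> /concave_functionP fD /concave_functionP gD.
apply/concave_functionP => t x y Dx Dy.
apply: le_trans (lerD (fD t x y Dx Dy) (gD t x y Dx Dy)).
by rewrite !mulrDr addrACA.
Qed.

Lemma concave_functionZ (c : R) f : 0 <= c -> concave_function D f ->
  concave_function D (fun x => c * f x).
Proof.
move=> c0 /concave_functionP fD; apply/concave_functionP => t x y Dx Dy.
apply: le_trans (ler_wpM2l c0 (fD t x y Dx Dy)).
by rewrite mulrDr !(mulrCA c).
Qed.

Lemma concave_function_sum (I : finType) (w : I -> R) (f : I -> E -> R) :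
  (forall i, 0 <= w i) -> (forall i, concave_function D (f i)) ->
  concave_function D (fun x => \sum_i w i * f i x).
Proof.
move=> w0 fD; elim: (index_enum I) => [|i s IH].
  under eq_fun do rewrite big_nil.
  exact: concave_function_cst.
under eq_fun do rewrite big_cons.
by apply: concave_functionD => //; apply: concave_functionZ.
Qed.

(** A lower bound for every argument, the initial value [f0] included, bounds the minimum. For a
    given argument, replace the minima at [x] and [y] by its larger values there and use its
    concavity. *)
Lemma concave_function_bigmin (I : finType) (f0 : E -> R) (f : I -> E -> R) :
  concave_function D f0 -> (forall i, concave_function D (f i)) ->
  concave_function D (fun x => \big[Num.min/f0 x]_i f i x).
Proof.
move=> /concave_functionP f0D fD; apply/concave_functionP => t x y Dx Dy.
apply: le_bigmin => [|i _].
  apply: le_trans (f0D t x y Dx Dy).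
  by rewrite lerD// ler_wpM2l// bigmin_le_id.
apply: le_trans ((concave_functionP _).1 (fD i) t x y Dx Dy).
by rewrite lerD// ler_wpM2l// bigmin_le.
Qed.

End ConcaveFunctions.

(** [phi] is controlled only on [[0, +oo[]. Nonnegativity of [f] on [D] keeps [f x], [f y] and their
    convex combination there; convexity of [D] does the same for the value of [f] at the combined
    point. *)
Lemma concave_activation (R : realType) (E : lmodType R)
    (D : set (convex_lmodType E)) (phi : activation R) (f : E -> R) :
  convex_set D -> {in D, forall x, 0 <= f x} ->
  concave_function D f -> concave_function D (fun x => phi (f x)).
Proof.
move=> cD f0 /concave_functionP fD; apply/concave_functionP => t x y Dx Dy.
have fx0 := f0 _ (mem_set Dx); have fy0 := f0 _ (mem_set Dy).
have fxy0 : 0 <= t%:num * f x + (1 - t%:num) * f y.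
  by rewrite addr_ge0// mulr_ge0// subr_ge0.
have Dxy := cD _ _ t (mem_set Dx) (mem_set Dy).
apply: le_trans (activation_nondecreasing phi _ _ (fD t x y Dx Dy)).
- have phiP := (concave_functionP (E := R^o) phi).1 (activation_concave phi).
  by apply: (phiP t (f x) (f y)); rewrite /= in_itv/= andbT.
- by rewrite in_itv/= fxy0.
- by rewrite in_itv/= f0.
Qed.

Section DSF.
Context {R : realType} {n : nat}.

(** Provides the nonnegativity that [concave_activation] demands at each appended layer. *)
Lemma dsf_output_ge0 k (N : dsf_network R n k) x i :
  nonneg_orthant R n x -> 0 <= dsf_output N x i.
Proof.
move=> x0; elim: N i => {k} [k phi w|k m N IH phi w b] i /=.
  by apply: activation_ge0; apply: sumr_ge0 => j _; apply: mulr_ge0.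
rewrite addr_ge0//; apply: activation_ge0.
by apply: sumr_ge0 => j _; apply: mulr_ge0.
Qed.

Lemma nonneg_orthant_convex :
  convex_set (nonneg_orthant R n : set (convex_lmodType 'rV[R]_n)).
Proof.
move=> x y t /set_mem x0 /set_mem y0; apply/mem_set => j.
by rewrite !mxE addr_ge0// mulr_ge0// subr_ge0.
Qed.

Lemma concave_dsf_output k (N : dsf_network R n k) i :
  concave_function (nonneg_orthant R n) (fun x => dsf_output N x i).
Proof.
elim: N i => {k} [k phi w|k m N IH phi w b] i /=.
  apply: (concave_activation _ _ _ (phi i)
    (fun x : 'rV[R]_n => \sum_j (w j i)%:num * x 0 j)).
  - exact: nonneg_orthant_convex.
  - by move=> x /set_mem x0; apply: sumr_ge0 => j _; apply: mulr_ge0.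
  apply: (concave_function_sum _ _ (fun j (x : 'rV[R]_n) => x 0 j)) => // j.
  (* A coordinate is linear, so its concavity inequality is an equality. *)
  by apply/concave_functionP => t x y _ _; rewrite !mxE.
(* The bias lies outside the activation and splits off as a constant. *)
apply: concave_functionD; last exact: concave_function_cst.
apply: (concave_activation _ _ _ (phi i)
    (fun x => \sum_u (w u i)%:num * dsf_output N x u)).
- exact: nonneg_orthant_convex.
- move=> x /set_mem x0; apply: sumr_ge0 => u _; apply: mulr_ge0 => //.
  exact: dsf_output_ge0.
exact: (concave_function_sum _ _ (fun u x => dsf_output N x u)).
Qed.

End DSF.

Theorem theorem3p12 (R : realType) (n : nat) (g : edsf R n) :
  (forall x : 'rV[R]_n, nonneg_orthant R n x -> 0 <= edsf_fun g x) /\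
  concave_function (nonneg_orthant R n) (edsf_fun g).
Proof.
split=> [x x0|].
  (* The initial value of the minimum is itself a component, so both goals concern a network
     output. *)
  by apply: le_bigmin => [|i _]; apply: dsf_output_ge0.
by apply: concave_function_bigmin => [|i]; apply: concave_dsf_output.
Qed.
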